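(* The substitution graph $\mathcal{U}$ generated by $\overrightarrow{G}$ and $\overrightarrow{J}$ is hyperbolic if and only if there exists a positive integer $k$ such that for every shortest horizontal path $p$ in $\mathcal{U}$ with length greater than $k$, the associated path matrix satisfies $M(p)=\mathbf{0}$ (the zero matrix).
   Context: Setting. Let $N\ge 2$, $\Sigma=\{1,\dots,N\}$, and let $\Sigma'=\{1',\dots,N'\}$ be a disjoint copy of $\Sigma$. Let $\overrightarrow{G}$ be a directed simple graph with vertex set $\Sigma$ (no loops, and at most one directed edge between any two vertices), with $E(\overrightarrow{G})\neq\emptyset$. Let $\overrightarrow{J}$ be a directed graph on $\Sigma\cup\Sigma'$ whose edge set is a nonempty subset of $\{(i,j'): i,j\in\Sigma\}$. Substitution graph. Let $\Sigma_n$ be the set of words of length $n$ over $\Sigma$ ($\Sigma_0=\{\varnothing\}$) and $V=\bigcup_{n\ge 0}\Sigma_n$. For a nonempty word $u$, $u^-$ is the word obtained by deleting the last letter of $u$ and $\varphi(u)\in\Sigma$ is the last letter of $u$. The vertical edges are $\overrightarrow{E}_v=\{(w,w\sigma): w\in V,\sigma\in\Sigma\}$. The set $\overrightarrow{E}_h$ of horizontal edges is defined recursively: for $n\ge1$ and distinct $u,v\in\Sigma_n$, $(u,v)\in\overrightarrow{E}_h$ iff either (i) $u^-=v^-$ and $(\varphi(u),\varphi(v))\in E(\overrightarrow{G})$, or (ii) $(u^-,v^-)\in\overrightarrow{E}_h$ and $(\varphi(u),\varphi(v)')\in E(\overrightarrow{J})$. The substitution graph $\mathcal{U}=(V,E)$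 is the underlying undirected graph of $\mathcal{D}=(V,\overrightarrow{E}_v\cup\overrightarrow{E}_h)$, and $E_h\subset E$ denotes the set of undirected horizontal edges. Hyperbolicity. Let $d$ be the graph distance in $\mathcal{U}$, $|u|=d(\varnothing,u)$, and $|u\wedge v|=\frac12(|u|+|v|-d(u,v))$. $\mathcal{U}$ is hyperbolic if there is $\delta\ge0$ with $|u\wedge v|\ge\min\{|u\wedge w|,|w\wedge v|\}-\delta$ for all $u,v,w\in V$. Paths. A horizontal path is a finite sequence of vertices $p=(u_0,\dots,u_\ell)$ with $(u_{q-1},u_q)\in E_h$ for all $q$ and distinct edges; its length is $\ell$. It is a shortest horizontal path if $\ell$ is minimal among all horizontal paths from $u_0$ to $u_\ell$. Path matrices. $K$ is the $N\times N$ $0$-$1$ matrix with $K_{i,j}=1$ iff $(i,j')\in E(\overrightarrow{J})$; $K_0=K$, $K_1=K^{\mathrm T}$. The direction sequence of $p=(u_0,\dots,u_\ell)$ is $d_1\cdots d_\ell$ with $d_q=0$ if $(u_{q-1},u_q)\in\overrightarrow{E}_h$ and $d_q=1$ if $(u_q,u_{q-1})\in\overrightarrow{E}_h$. The path matrix is $M(p)=K_{d_1}K_{d_2}\cdots K_{d_\ell}$. *)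

(* Defs.v *)
From mathcomp Require Import all_boot all_order all_algebra.
From mathcomp Require Import boolp reals.

Set Implicit Arguments.
Unset Strict Implicit.
Unset Printing Implicit Defensive.
Import Order.TTheory GRing.Theory Num.Theory.
Local Open Scope ring_scope.

(* Words over 'I_N are stored with their last letter at the head: the child
   w sigma of w is sigma :: w, so that for a nonempty word i :: u the parent
   u^- is u and the last letter is i. *)
Notation word N := (seq 'I_N).

Definition vedge (N : nat) (u v : word N) : bool :=
  if v is _ :: w then u == w else false.

(* In J, inl i stands for the letter i and inr j for the primed letter j'. *)
Fixpoint hedge (N : nat) (G : rel 'I_N) (J : rel ('I_N + 'I_N))
    (u v : word N) : bool :=
  match u, v with
  | i :: u', j :: v' =>
      [&& size u == size v, u != v &
          ((u' == v') && G i j) || (hedge G J u' v' && J (inl i) (inr j))]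
  | _, _ => false
  end.

Definition dedge (N : nat) (G : rel 'I_N) (J : rel ('I_N + 'I_N))
    (u v : word N) : bool :=
  vedge u v || hedge G J u v.

Definition uadj (N : nat) (G : rel 'I_N) (J : rel ('I_N + 'I_N)) :
    rel (word N) :=
  fun u v => dedge G J u v || dedge G J v u.

Definition hadj (N : nat) (G : rel 'I_N) (J : rel ('I_N + 'I_N)) :
    rel (word N) :=
  fun u v => hedge G J u v || hedge G J v u.

Definition walk (N : nat) (G : rel 'I_N) (J : rel ('I_N + 'I_N))
    (u v : word N) (n : nat) : Prop :=
  exists p : seq (word N), [/\ path (uadj G J) u p, last u p = v & size p = n].

Lemma walk_ex (N : nat) (G : rel 'I_N) (J : rel ('I_N + 'I_N)) (u v : word N) :
  exists n, `[< walk G J u v n >].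
Proof.
have down (w : word N) : exists p, path (uadj G J) [::] p /\ last [::] p = w.
  elim: w => [|i w [p [pP pw]]]; first by exists [::].
  exists (rcons p (i :: w)); rewrite rcons_path pP pw last_rcons; split=> //.
  by rewrite /= /uadj /dedge /= eqxx.
have up (w : word N) : exists p, path (uadj G J) w p /\ last w p = [::].
  elim: w => [|i w [p [pP pw]]]; first by exists [::].
  exists (w :: p); split=> //=; rewrite pP andbT.
  by rewrite /uadj /dedge /= eqxx /= orbT.
have [p [pP pu]] := up u; have [q [qP qv]] := down v.
exists (size (p ++ q)); apply/asboolP; exists (p ++ q).
by rewrite cat_path last_cat pu pP qP qv.
Qed.

Definition dist (N : nat) (G : rel 'I_N) (J : rel ('I_N + 'I_N))
    (u v : word N) : nat :=
  ex_minn (walk_ex G J u v).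

Definition gromov (R : realType) (N : nat) (G : rel 'I_N)
    (J : rel ('I_N + 'I_N)) (u v : word N) : R :=
  ((dist G J [::] u)%:R + (dist G J [::] v)%:R - (dist G J u v)%:R) / 2.

Definition hyperbolic (R : realType) (N : nat) (G : rel 'I_N)
    (J : rel ('I_N + 'I_N)) : Prop :=
  exists2 delta : R, 0 <= delta &
    forall u v w : word N,
      Num.min (gromov R G J u w) (gromov R G J w v) - delta
        <= gromov R G J u v.

(* The path (u_0, ..., u_l) is given by u = u_0 and p = [:: u_1; ...; u_l];
   its length is size p. *)
Definition path_edges (N : nat) (u : word N) (p : seq (word N)) :
    seq (word N * word N) :=
  zip (u :: p) p.

Definition hpath (N : nat) (G : rel 'I_N) (J : rel ('I_N + 'I_N))
    (u : word N) (p : seq (word N)) : Prop :=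
  path (hadj G J) u p /\
  pairwise (fun e f => (e != f) && (e != (f.2, f.1))) (path_edges u p).

Definition shortest_hpath (N : nat) (G : rel 'I_N) (J : rel ('I_N + 'I_N))
    (u : word N) (p : seq (word N)) : Prop :=
  hpath G J u p /\
  forall q : seq (word N),
    hpath G J u q -> last u q = last u p -> (size p <= size q)%N.

Definition Kmx (N : nat) (J : rel ('I_N + 'I_N)) : 'M[int]_N :=
  \matrix_(i, j) (J (inl i) (inr j))%:R.

(* For hadj-adjacent x, y exactly one of hedge x y and hedge y x holds as soon
   as G is irreflexive and antisymmetric, so ~~ hedge x y is direction 1. *)
Definition directions (N : nat) (G : rel 'I_N) (J : rel ('I_N + 'I_N))
    (u : word N) (p : seq (word N)) : seq bool :=
  [seq ~~ hedge G J e.1 e.2 | e <- path_edges u p].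

Definition path_mx (N : nat) (G : rel 'I_N) (J : rel ('I_N + 'I_N))
    (u : word N) (p : seq (word N)) : 'M[int]_N :=
  \big[mulmx/1%:M]_(d <- directions G J u p)
     (if d then (Kmx J)^T else Kmx J).

(* Main.v *)
Require Import Defs.
From mathcomp Require Import all_boot all_order all_algebra.
From mathcomp Require Import boolp reals.
From mathcomp Require Import zify lra.

(** Every vertical edge changes the level by one and every horizontal edge
    projects, under [behead], to a horizontal edge or to a point. Hence the
    ups of a walk can be moved to its front and its downs to its end without
    lengthening it: the distance between [u] and [v] is attained by climbing to
    some level [l], moving horizontally there, and descending
    ([dist_bridge]).

    A product of the 0-1 matrices [K] and [K^T] along a path has a nonzero
    entry (i, j) exactly when the path lifts, edge by edge, to a path one level
    lower from a child with last letter i to a child with last letter j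
    ([path_mx_lift]). Both implications turn this into metric information.

    Suppose the path matrices of shortest horizontal paths longer than [k]
    vanish. A horizontal path of length [k + 1] then gets shorter when it is
    projected to the parents of its vertices: otherwise all its edges are lifts
    and its projection is a shortest path with nonzero matrix
    ([hreach_contract]). So [3 (k + 1)] horizontal steps can be replaced by one
    step up, [3 k] horizontal steps and one step down, and the horizontal part
    of a geodesic may be taken of length at most [3 (k + 1)]
    ([bridge_short]). The Gromov product of [u] and [v] is then, up to a
    constant, the level [l], and two horizontal parts ending at a common word
    project to the smaller of their levels, where they can be concatenated:
    this is the four-point inequality.

    Conversely, let [p] be a long shortest horizontal path with nonzero matrix.
    On a lift of [p], two vertices far apart have the same last letter i
    ([path_mx_loop]). The piece of [p] between them has a nonzero diagonal
    entry (i, i), so it lifts forever along the letter i, the directions of its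
    edges being preserved. All these lifts are shortest horizontal paths, and
    deep enough they are geodesics of the whole graph, since going back up to a
    level with a shortcut is too expensive ([dist_lift_loop]). A horizontal
    geodesic is a degenerate triangle whose midpoint violates the four-point
    inequality when it is long, which bounds its length by a multiple of the
    hyperbolicity constant ([hyperbolic_loop]). *)

(** * Subpaths *)

Lemma path_sub {T : Type} {e : rel T} {z : T} {p : seq T} {s t : nat} :
  path e z p -> s <= t -> t <= size p ->
  exists r, [/\ path e (nth z (z :: p) s) r,
    last (nth z (z :: p) s) r = nth z (z :: p) t & size r = t - s].
Proof.
have lastn z' q n : n <= size q -> last z' (take n q) = nth z (z' :: q) n.
  elim: n z' q => [|n IHn] z' [|z'' q] //= nq.
  exact: IHn.
move=> pP st tp.
have := pP; rewrite -[p in path _ _ p](cat_take_drop s) cat_path lastn; last lia.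
move=> /andP[_ dP]; exists (take (t - s) (drop s p)); split.
- exact: take_path.
- rewrite lastn ?size_drop; last lia.
  rewrite -{2}(subnKC st); case: (t - s) => [|m]; first by rewrite addn0.
  by rewrite addnS /= nth_drop.
- by rewrite size_takel // size_drop; lia.
Qed.

Local Open Scope ring_scope.

Section SubstitutionGraph.

Set Implicit Arguments.
Unset Strict Implicit.
Import Order.TTheory GRing.Theory Num.Theory.
Local Open Scope nat_scope.

Variables (N : nat) (G : rel 'I_N) (J : rel ('I_N + 'I_N)).
Implicit Types (u v w x y : word N) (p q r : seq (word N)) (i j : 'I_N).

Local Notation hadj := (hadj G J).
Local Notation hedge := (hedge G J).
Local Notation dist := (dist G J).

(** * Horizontal edges *)

Lemma hedge_neq u v : hedge u v -> u != v.
Proof. by case: u v => [|i u] [|j v] //= /and3P[]. Qed.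

Lemma hedge_size u v : hedge u v -> size u = size v.
Proof. by case: u v => [|i u] [|j v] //= /and3P[/eqP ->]. Qed.

Lemma hedge_behead u v : hedge u v ->
  behead u = behead v \/ hedge (behead u) (behead v).
Proof.
case: u v => [|i u] [|j v] //= /and3P[_ _ /orP[/andP[/eqP-> _]|/andP[? _]]].
  by left.
by right.
Qed.

Lemma hadj_neq u v : hadj u v -> u != v.
Proof. by move=> /orP[|] /hedge_neq //; rewrite eq_sym. Qed.

Lemma hadj_size u v : hadj u v -> size u = size v.
Proof. by move=> /orP[|] /hedge_size. Qed.

Lemma hadj_behead u v : hadj u v ->
  behead u = behead v \/ hadj (behead u) (behead v).
Proof.
rewrite /Defs.hadj => /orP[|] /hedge_behead[->|->]; try by left.
- by right.
- by rewrite orbT; right.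
Qed.

(** * Horizontal distance *)

(** The length is only bounded, so that contracting edges to points, as the
    projection to parents does, preserves [hreach n]. *)
Definition hreach n u v : Prop :=
  exists p, [/\ path hadj u p, last u p = v & size p <= n].

Lemma hreach_refl n u : hreach n u u.
Proof. by exists [::]. Qed.

Lemma hreach_path u p : path hadj u p -> hreach (size p) u (last u p).
Proof. by exists p. Qed.

Lemma hreach_le m n u v : m <= n -> hreach m u v -> hreach n u v.
Proof. by move=> mn [p [? ? pm]]; exists p; split=> //; apply: leq_trans mn. Qed.

Lemma hreach_trans m n u v w :
  hreach m u v -> hreach n v w -> hreach (m + n) u w.
Proof.
move=> [p [pP pv pm]] [q [qP qw qn]]; exists (p ++ q).
by rewrite cat_path last_cat pv pP qP qw size_cat leq_add.
Qed.

Lemma hreach_split m n u w : hreach (m + n) u w ->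
  exists2 v, hreach m u v & hreach n v w.
Proof.
move=> [p [pP pw pmn]]; exists (last u (take m p)).
  by exists (take m p); rewrite take_path // size_take_min geq_minl.
move: pP pw; rewrite -{1 2}[p](cat_take_drop m) cat_path last_cat.
move=> /andP[_ dP] dw.
by exists (drop m p); rewrite dP size_drop; split=> //; lia.
Qed.

Lemma hreach_size n u v : hreach n u v -> size u = size v.
Proof.
move=> [p [pP <- _]]; elim: p u pP => //= w p IHp u /andP[/hadj_size-> pP].
exact: IHp.
Qed.

Lemma hreach_cons n u v w :
  u = v \/ hadj u v -> hreach n v w -> hreach n.+1 u w.
Proof.
move=> [-> | uv]; first exact: hreach_le.
by move=> vw; apply: (hreach_trans (m := 1)) vw; exists [:: v]; rewrite /= uv.
Qed.

Lemma hreach_behead n u v : hreach n u v -> hreach n (behead u) (behead v).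
Proof.
move=> [p [pP <- pn]]; apply: hreach_le pn _.
elim: p u pP => [|w p IHp] u /=; first by move=> _; apply: hreach_refl.
by move=> /andP[/hadj_behead uw /IHp]; apply: hreach_cons.
Qed.

Lemma hreach_drop n m u v : hreach n u v -> hreach n (drop m u) (drop m v).
Proof.
move=> uv; elim: m => [|m /hreach_behead]; first by rewrite !drop0.
by rewrite -!drop1 !drop_drop.
Qed.

(** * Ancestors and normal forms of walks *)

Definition anc l u := drop (size u - l) u.

Lemma size_anc l u : l <= size u -> size (anc l u) = l.
Proof. by move=> lu; rewrite size_drop subKn. Qed.

Lemma anc_anc l m u : l <= m -> m <= size u -> anc l (anc m u) = anc l u.
Proof.
by move=> lm mu; rewrite {1}/anc size_anc // /anc drop_drop; congr drop; lia.
Qed.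

Lemma anc_size u : anc (size u) u = u.
Proof. by rewrite /anc subnn drop0. Qed.

Lemma anc_cat l s u : l <= size u -> anc l (s ++ u) = anc l u.
Proof.
move=> lu; rewrite /anc size_cat -addnBA // drop_cat ifF; last lia.
by congr drop; lia.
Qed.

Lemma behead_anc l u : l < size u -> behead (anc l.+1 u) = anc l u.
Proof. by move=> lu; rewrite -drop1 /anc drop_drop; congr drop; lia. Qed.

Lemma hreach_anc n l u v : hreach n u v -> hreach n (anc l u) (anc l v).
Proof. by move=> uv; rewrite /anc (hreach_size uv); apply: hreach_drop. Qed.

Lemma hreach_anc_le n l m u v : l <= m -> m <= size u -> m <= size v ->
  hreach n (anc m u) (anc m v) -> hreach n (anc l u) (anc l v).
Proof.
by move=> lm mu mv /(@hreach_anc n l); rewrite !anc_anc.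
Qed.

(** A walk from [u] up to level [l], then [b] horizontal steps, then down to
    [v] has length [(size u - l) + b + (size v - l)]; the last clause says that
    this is at most [n], without truncated subtraction. *)
Definition bridge u v n l b :=
  [/\ l <= size u, l <= size v, hreach b (anc l u) (anc l v)
    & size u + size v + b <= n + l.*2].

Lemma uadjP u v : uadj G J u v ->
  [\/ exists i, u = i :: v, exists i, v = i :: u | hadj u v].
Proof.
rewrite /uadj /dedge /vedge => /orP[/orP[|h]|/orP[|h]].
- by case: v => // i v /eqP ->; constructor 2; exists i.
- by constructor 3; rewrite /Defs.hadj h.
- by case: u => // i u /eqP ->; constructor 1; exists i.
- by constructor 3; rewrite /Defs.hadj h orbT.
Qed.

(** A walk can be normalized because a horizontal step or a step down followed
    by a step up may be replaced by going up first and taking the projected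
    step, which is never longer. *)
Lemma walk_bridge u v n : walk G J u v n -> exists l b, bridge u v n l b.
Proof.
move=> [p [pP <- <-]] {v n}; elim: p u pP => [|w p IHp] u /=.
  move=> _; exists (size u), 0; split=> //; last lia.
  exact: hreach_refl.
move=> /andP[/uadjP uw /IHp]; move: (last w p) => v {IHp}.
move=> [l [b [lw lv wv cost]]].
case: uw => [[i eu]|[i ew]|uw].
- exists l, b; split=> //; rewrite eu /=; [lia | | lia].
  by rewrite -cat1s anc_cat.
- have [lu | ul] := leqP l (size u).
    exists l, b; split=> //; move: wv cost; rewrite ew /=; last lia.
    by rewrite -cat1s anc_cat.
  (* The walk first descends and its horizontal part lies at the level reached:
     that part is projected one level up, to the level of [u]. *)
  have el : l = (size u).+1 by move: lw; rewrite ew /=; lia.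
  subst l; exists (size u), b; split=> //; [lia | | rewrite ew /= in cost; lia].
  rewrite -(@anc_cat _ [:: i]) // cat1s -ew.
  by apply: hreach_anc_le wv; rewrite ?ew.
- have su := hadj_size uw; exists l, b.+1; split; rewrite ?su //; last lia.
  rewrite -[b.+1]add1n; apply: hreach_trans wv; apply: hreach_anc.
  by apply: hreach_cons (hreach_refl 0 w); right.
Qed.

Lemma bridge_walk u v l b : l <= size u -> l <= size v ->
  hreach b (anc l u) (anc l v) ->
  exists2 n, walk G J u v n & n + l.*2 <= size u + size v + b.
Proof.
have up w m : m <= size w -> exists p,
    [/\ path (uadj G J) w p, last w p = anc m w & size p + m = size w].
  elim: w => [|i w IHw]; first by rewrite leqn0 => /eqP->; exists [::].
  rewrite leq_eqVlt => /orP[/eqP-> | mw].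
    by exists [::]; rewrite anc_size.
  have [p [pP pl ps]] := IHw mw; exists (w :: p); rewrite /= pP pl; split.
  - by rewrite /uadj /dedge /= eqxx orbT.
  - by rewrite -(cat1s i w) anc_cat.
  - lia.
have uadjC x y : uadj G J x y = uadj G J y x by exact: orbC.
move=> lu lv [r [rP rl rb]].
have [p [pP pl ps]] := up u l lu; have [q [qP ql qs]] := up v l lv.
exists (size (p ++ r ++ rev (belast v q))).
  exists (p ++ r ++ rev (belast v q)); split=> //.
    rewrite !cat_path pP pl rl -ql rev_path /=; apply/andP; split.
      apply: sub_path rP => x y; rewrite /uadj /dedge.
      by move=> /orP[|] ->; rewrite ?orbT.
    by rewrite (eq_path (e' := uadj G J)).
  rewrite !last_cat pl rl -ql; case: (q) => //= z q'.
  by rewrite rev_cons last_rcons.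
rewrite !size_cat size_rev size_belast; lia.
Qed.

Lemma dist_le_bridge u v l b : l <= size u -> l <= size v ->
  hreach b (anc l u) (anc l v) -> dist u v + l.*2 <= size u + size v + b.
Proof.
move=> lu lv /(bridge_walk lu lv)[n w]; apply: leq_trans.
by rewrite leq_add2r /Defs.dist; case: ex_minnP => m _; apply; apply/asboolP.
Qed.

Lemma dist_bridge u v : exists l b, bridge u v (dist u v) l b.
Proof.
by apply: walk_bridge; rewrite /Defs.dist; case: ex_minnP => m /asboolP.
Qed.

Lemma dist_nil u : dist [::] u = size u.
Proof.
apply/eqP; rewrite eqn_leq; apply/andP; split.
  have := @dist_le_bridge [::] u 0 0; rewrite /= addn0 addn0; apply=> //.
  by rewrite {2}/anc subn0 drop_size; apply: hreach_refl.
have [l [b [l0 _ _]]] := dist_bridge [::] u.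
move: l0; rewrite leqn0 => /eqP->; rewrite /=; lia.
Qed.

Lemma dist_hreach n u v : hreach n u v -> dist u v <= n.
Proof.
move=> uv; have suv := hreach_size uv.
have := @dist_le_bridge u v (size u) n; rewrite -suv !anc_size suv anc_size.
move=> /(_ (leqnn _) (leqnn _) uv); lia.
Qed.

(** * Path matrices and lifts of paths *)

Lemma sum_neq0 (A : numDomainType) (I : finType) (F : I -> A) :
  (forall k, 0 <= F k)%R ->
  ((\sum_k F k)%R != 0%R) <-> exists k, F k != 0%R.
Proof.
move=> F0; split=> [|[k Fk]].
  case: (pickP (fun k => F k != 0%R)) => [k|F_eq0]; first by exists k.
  by rewrite big1 ?eqxx // => k _; apply/eqP/negbFE/F_eq0.
apply: contra_neq Fk => /eqP.
by rewrite psumr_eq0 // => /allP/(_ k)/= /(_ (mem_index_enum _)) /eqP.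
Qed.

Lemma path_mx_cons u v p :
  path_mx G J u (v :: p) =
    ((if hedge u v then Kmx J else (Kmx J)^T) *m path_mx G J v p)%R.
Proof.
by rewrite /path_mx /directions /= big_cons /=; case: (hedge u v).
Qed.

Lemma step_mxE (d : bool) i j :
  (if d then Kmx J else (Kmx J)^T)%R i j =
    ((if d then J (inl i) (inr j) else J (inl j) (inr i))%:R)%R.
Proof. by case: d; rewrite !mxE. Qed.

Lemma path_mx_ge0 u p i j : (0 <= path_mx G J u p i j)%R.
Proof.
elim: p u i => [|v p IHp] u i.
  by rewrite /path_mx /= big_nil mxE ler0n.
rewrite path_mx_cons mxE sumr_ge0 // => k _.
by rewrite mulr_ge0 // step_mxE ler0n.
Qed.

Hypothesis G_noloop : forall i, ~~ G i i.
Hypothesis G_simple : forall i j, G i j -> ~~ G j i.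

(** Without this the direction read off by [directions] would not determine
    which of the two orientations of an edge has to be lifted. *)
Lemma hedge_asym u v : hedge u v -> ~~ hedge v u.
Proof.
elim: u v => [|i u IHu] [|j v] //= /and3P[_ _].
move=> /orP[/andP[/eqP <- Gij]|/andP[uv _]].
  rewrite (negPf (G_simple Gij)) andbF /=.
  by case: (boolP (hedge u u)) => [/hedge_neq|]; rewrite ?eqxx ?andbF.
rewrite (negPf (IHu _ uv)) /= orbF (eq_sym v u) (negPf (hedge_neq uv)).
by rewrite !andbF.
Qed.

(** The horizontal edges whose endpoints have different parents are those that
    arise from an edge between the parents and an edge of [J]. *)
Definition lifted_adj x y := hadj x y && hadj (behead x) (behead y).

Lemma lifted_adj_cons i j u v : hadj u v ->
  lifted_adj (i :: u) (j :: v) =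
    if hedge u v then J (inl i) (inr j) else J (inl j) (inr i).
Proof.
move=> uv; have [su nuv] := (hadj_size uv, hadj_neq uv).
rewrite /lifted_adj /= uv andbT /Defs.hadj /= su eqxx !eqseq_cons (eq_sym v).
rewrite (negPf nuv) !andbF /=.
move: uv; rewrite /Defs.hadj; case: ifP => [uv _|_ /= -> //].
by rewrite (negPf (hedge_asym uv)) orbF.
Qed.

Lemma path_behead x q :
  path lifted_adj x q -> path hadj (behead x) (map behead q).
Proof. by rewrite path_map; apply: sub_path => y z /andP[]. Qed.

Lemma path_lifted x q : path lifted_adj x q -> path hadj x q.
Proof. by apply: sub_path => y z /andP[]. Qed.

(** Lifting an edge preserves its direction; hence a path and its lift have the
    same matrix, which is what makes lifting iterable. *)
Lemma directions_lifted x q : path lifted_adj x q ->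
  directions G J x q = directions G J (behead x) (map behead q).
Proof.
elim: q x => //= y q IHq x /andP[xy /IHq IH].
rewrite /directions /= -/(directions G J y q) IH /directions /=; congr (_ :: _).
have /andP[hxy] := xy; case: x y xy hxy {IH IHq} => [|i u] [|j v] //=.
move=> xy hxy uv; have [su nuv] := (hadj_size uv, hadj_neq uv).
move: hxy; rewrite (lifted_adj_cons _ _ uv) in xy.
rewrite su eqxx !eqseq_cons (negPf nuv) andbF /=.
by case: ifP xy => [_ -> |].
Qed.

(** By nonnegativity no cancellation occurs in the matrix product, so a nonzero
    entry is the same as a sequence of letters all of whose steps are allowed
    by [K] or [K^T]; appending these letters to the vertices gives the lift. *)
Lemma path_mx_lift u p i j : path hadj u p ->
  path_mx G J u p i j != 0%R <->
  exists q, [/\ path lifted_adj (i :: u) q, map behead q = p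
               & last (i :: u) q = j :: last u p].
Proof.
elim: p u i => [|v p IHp] u i.
  move=> _; rewrite /path_mx /= big_nil mxE; split=> [|[[|? ?] []]] //.
    by case: (i =P j) => [->|_]; rewrite ?eqxx // => _; exists [::].
  by move=> _ _ /= [->]; rewrite eqxx.
move=> /= /andP[uv pP]; rewrite path_mx_cons mxE.
rewrite sum_neq0 => [|k]; last first.
  by rewrite mulr_ge0 ?path_mx_ge0 // step_mxE ler0n.
split=> [[k]|[[|y q] []]] //.
  rewrite mulf_eq0 negb_or step_mxE -(lifted_adj_cons i k uv) => /andP[ik].
  move=> /(IHp _ _ pP)[q [qP qp ql]].
  exists ((k :: v) :: q); rewrite /= qp ql qP andbT; split=> //.
  by move: ik; case: lifted_adj.
move=> /= /andP[iy qP] [yv qp] ql.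
case: y iy qP yv ql => [/andP[/hadj_size]//|k v'] iy qP /= e; subst v'.
move=> ql; exists k.
rewrite mulf_eq0 negb_or step_mxE -(lifted_adj_cons i k uv) iy /=.
by apply/(IHp _ _ pP); exists q.
Qed.

(** * Shortest horizontal paths *)

Lemma uniq_path_edges u p : uniq (u :: p) ->
  pairwise (fun e f : word N * word N => (e != f) && (e != (f.2, f.1)))
    (path_edges u p).
Proof.
have mem w q e : e \in path_edges w q -> e.1 \in w :: q /\ e.2 \in q.
  elim: q w => //= z q IHq w; rewrite inE => /orP[/eqP-> | /IHq[e1 e2]].
    by rewrite !inE !eqxx.
  by rewrite !inE e2 orbT; split=> //; apply/orP; right.
elim: p u => // v p IHp u /= /andP[up uniqp].
rewrite (IHp v uniqp) andbT; apply/allP => e /mem[e1 e2].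
have ne w : w \in v :: p -> u != w by apply: contraTneq => <-.
have {}e2 : e.2 \in v :: p by rewrite inE e2 orbT.
apply/andP; split; apply/negP => /eqP E.
- by move: (ne _ e1); rewrite -E eqxx.
- by case: E (ne _ e2) => ->; rewrite eqxx.
Qed.

(** Erasing loops from a walk makes its vertices, hence its edges, distinct. *)
Lemma hreach_hpath n u v : hreach n u v ->
  exists p, [/\ hpath G J u p, last u p = v & size p <= n].
Proof.
move=> [p [pP <- pn]]; case: (shortenP pP) => q qP uq qp.
exists q; split=> //; first by split=> //; apply: uniq_path_edges.
by apply: leq_trans pn; apply: uniq_leq_size; move: uq => /= /andP[].
Qed.

(** By loop erasure, being shortest among the horizontal paths with distinct
    edges is the same as being shortest among all horizontal walks. *)
Lemma shortest_hpathP u p : path hadj u p ->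
  (forall n, hreach n u (last u p) -> size p <= n) <-> shortest_hpath G J u p.
Proof.
move=> pP; split=> [min|[_ min] n /hreach_hpath[q [qP ql qn]]]; last first.
  exact: leq_trans (min q qP ql) qn.
split=> [|q [qP _] ql]; last by apply: min; rewrite -ql; apply: hreach_path.
split=> //; apply: uniq_path_edges.
case: (shortenP pP) min => q qP uq qp /(_ _ (hreach_path qP)) pq.
have sub : {subset u :: q <= u :: p}.
  by move=> x; rewrite !inE => /orP[-> //|/qp ->]; rewrite orbT.
exact: leq_size_uniq uq sub pq.
Qed.

(** * Vanishing path matrices imply hyperbolicity *)

Section Sufficiency.

Variable k : nat.
Hypothesis shortest_mx0 : forall u p,
  shortest_hpath G J u p -> k < size p -> path_mx G J u p = 0%R.

(** Either some edge collapses in the projection, or the whole path is a lift of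
    its projection. In the second case the projection has a nonzero matrix and
    length [k + 1], so it is not shortest. *)
Lemma hreach_contract u v : hreach k.+1 u v -> hreach k (behead u) (behead v).
Proof.
move=> [p [pP <- pk]].
have [|kp] := leqP (size p) k.
  by move=> pk'; apply: hreach_le pk' _; apply/hreach_behead/hreach_path.
have stay q w : path hadj w q ->
    path lifted_adj w q \/ hreach (size q).-1 (behead w) (behead (last w q)).
  elim: q w => [|x q IHq] w /=; first by left.
  move=> /andP[wx qP]; have [wx'|wx'] := hadj_behead wx.
    by right; rewrite wx'; apply/hreach_behead/hreach_path.
  have wxL : lifted_adj w x by rewrite /lifted_adj wx wx'.
  case: (IHq x qP) => [->|]; first by left; rewrite wxL.
  case: q {IHq} qP => [|y q] //= qP h; first by left; rewrite wxL.
  by right; apply: hreach_cons h; right.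
have [pL|] := stay p u pP; last by apply: hreach_le; lia.
case: (pselect (hreach k (behead u) (behead (last u p)))) => // nk.
have pP' := path_behead pL.
have min n : hreach n (behead u) (behead (last u p)) -> k < n.
  by move=> h; rewrite ltnNge; apply: contra_notN nk => /hreach_le; apply.
case: p => [//|y p] in pP pk kp pL nk pP' min *.
case: u => [|i u] in pP pk pL nk pP' min *.
  by case/andP: (pP); case: (y).
have lastE : behead (last (i :: u) (y :: p)) = last u (map behead (y :: p)).
  exact/esym/(last_map behead (y :: p) (i :: u)).
have /shortest_mx0 : shortest_hpath G J u (map behead (y :: p)).
  apply/(shortest_hpathP pP') => n.
  by rewrite -lastE size_map => /min; apply: leq_trans.
rewrite size_map => /(_ kp) M0.
have : last (i :: u) (y :: p) != [::].
  by rewrite -size_eq0 -(hreach_size (hreach_path pP)).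
case E : (last _ _) => [|j y'] // _.
suff: path_mx G J u (map behead (y :: p)) i j != 0%R by rewrite M0 mxE eqxx.
by apply/path_mx_lift => //; exists (y :: p); rewrite -lastE E.
Qed.

Let L := 3 * k.+1.

(** Three contractions gain three horizontal steps, which pays for the two
    vertical steps needed to move the bridge one level up. *)
Lemma bridge_short u v : exists l b, bridge u v (dist u v) l b /\ b <= L.
Proof.
have [l [b]] := dist_bridge u v; elim/ltn_ind: b l => b IHb l ub.
have [bL|Lb] := leqP b L; first by exists l, b.
case: l ub => [|l] [lu lv uv cost].
  exists 0, 0; split=> //; split=> //; last lia.
  by rewrite /anc !subn0 !drop_size; apply: hreach_refl.
apply: (IHb (b - 3) _ l); first by lia.
split; [lia | lia | | lia].
rewrite -(behead_anc lu) -(behead_anc lv).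
have eb : b = k.+1 + (k.+1 + (k.+1 + (b - L))) by rewrite /L in Lb *; lia.
move: uv; rewrite {1}eb => /hreach_split[w1 /hreach_contract h1].
move=> /hreach_split[w2 /hreach_contract h2].
move=> /hreach_split[w3 /hreach_contract h3] /hreach_behead h4.
have := hreach_trans h1 (hreach_trans h2 (hreach_trans h3 h4)).
by apply: hreach_le; rewrite /L in Lb *; lia.
Qed.

Local Open Scope ring_scope.

Lemma bridge_gromov (R : realType) u v l b : bridge u v (dist u v) l b ->
  gromov R G J u v <= l%:R.
Proof.
move=> [_ _ _ cost]; rewrite /gromov !dist_nil.
have : ((size u + size v)%:R <= (dist u v + l.*2)%:R :> R).
  by rewrite ler_nat; lia.
rewrite -muln2 !natrD natrM; lra.
Qed.

(** The bridges [u]-[w] and [w]-[v] are projected to the smaller of their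
    levels, where the ancestors of [w] agree. *)
Lemma hyperbolic_of_path_mx (R : realType) : hyperbolic R G J.
Proof.
exists L%:R => [|u v w]; first exact: ler0n.
have [l1 [b1 [B1 bL1]]] := bridge_short u w.
have [l2 [b2 [B2 bL2]]] := bridge_short w v.
have [g1 g2] := (bridge_gromov R B1, bridge_gromov R B2).
move: B1 B2 => [l1u l1w h1 _] [l2w l2v h2 _].
set l := minn l1 l2.
have [ll1 ll2] : (l <= l1)%N /\ (l <= l2)%N by rewrite geq_minl geq_minr.
have {}h1 := hreach_anc_le ll1 l1u l1w h1.
have {}h2 := hreach_anc_le ll2 l2w l2v h2.
have := hreach_trans h1 h2.
move/(dist_le_bridge (leq_trans ll1 l1u) (leq_trans ll2 l2v)) => d.
have {}d : ((dist u v + l.*2)%:R <= (size u + size v + L.*2)%:R :> R).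
  by rewrite ler_nat; lia.
have g : Num.min (gromov R G J u w) (gromov R G J w v) <= l%:R.
  rewrite /l; case: (leqP l1 l2) => _; rewrite ge_min; first by rewrite g1.
  by rewrite g2 orbT.
move: d g; rewrite [gromov R G J u v]/gromov !dist_nil -!muln2 !natrD !natrM.
lra.
Qed.

End Sufficiency.

(** * Hyperbolicity implies vanishing path matrices *)

Section Necessity.

Local Open Scope nat_scope.

Variables (x y : word N) (r : seq (word N)) (i : 'I_N).
Hypotheses (rP : path hadj x r) (ry : last x r = y).
Hypothesis r_min : forall b, hreach b x y -> size r <= b.
Hypothesis r_loop : path_mx G J x r i i != 0%R.

(** The lift of a path through the diagonal entry (i, i) has the same directions
    as the path, hence the same nonzero entry, and can be lifted again. *)
Lemma lift_loop m : exists q,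
  [/\ path hadj (nseq m i ++ x) q, last (nseq m i ++ x) q = nseq m i ++ y
    & directions G J (nseq m i ++ x) q = directions G J x r].
Proof.
elim: m => [|m [q [qP ql qd]]]; first by exists r.
have : path_mx G J (nseq m i ++ x) q i i != 0%R by rewrite /path_mx qd.
move=> /(path_mx_lift i i qP)[q' [q'P q'q q'l]].
exists q'; split; rewrite ?(path_lifted q'P) //; first by rewrite /= q'l ql.
by rewrite directions_lifted // q'q.
Qed.

(* After [size r] lifts, climbing back to the level of [x] and descending again
   costs at least [2 * size r], so it saves nothing over the horizontal path. *)
Let l := size r.
Let a := nseq l i ++ x.
Let b := nseq l i ++ y.

Lemma size_xy : size x = size y.
Proof. by rewrite -ry; apply/hreach_size/hreach_path. Qed.

Lemma hreach_lift_loop : hreach l a b.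
Proof.
have [q [qP ql /(congr1 size)]] := lift_loop l.
move=> qs; exists q; split=> //; move: qs.
by rewrite /directions !size_map /path_edges !size_zip /= !minnE; lia.
Qed.

(** A bridge at or below the level of [x] projects to a horizontal path from [x]
    to [y]; a bridge above that level needs [size r] steps up and down. *)
Lemma dist_lift_loop : l <= dist a b.
Proof.
have [h [e [ha hb hab cost]]] := dist_bridge a b.
have sxy := size_xy.
have [sa sb] : size a = l + size x /\ size b = l + size x.
  by rewrite !size_cat !size_nseq sxy.
have [hx|xh] := ltnP h (size x); first by move: cost; lia.
have /r_min le : hreach e x y.
  have := hreach_anc_le xh ha hb hab.
  by rewrite /a /b !anc_cat -?sxy // anc_size sxy anc_size.
by move: cost; lia.
Qed.

Local Open Scope ring_scope.

(** For a horizontal geodesic of length [2 m] at level [h], the endpoints have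
    Gromov product at most [h - m], while each has Gromov product at least
    [h - m / 2] with the midpoint. *)
Lemma hyperbolic_loop (R : realType) (delta : R) m :
  (forall u v w, Num.min (gromov R G J u w) (gromov R G J w v) - delta
        <= gromov R G J u v) -> size r = m.*2 -> m%:R <= 2 * delta.
Proof.
move=> hyp sr; have := hreach_lift_loop; rewrite /l sr -addnn.
move=> /hreach_split[w aw wb]; have sab := hreach_size hreach_lift_loop.
have := hyp a b w; have := dist_lift_loop.
move: (dist_hreach aw) (dist_hreach wb); rewrite /gromov !dist_nil /l sr.
rewrite -(hreach_size aw) -sab -muln2.
rewrite -!(ler_nat R) natrM => daw dwb dab.
rewrite lerBlDr ge_min => /orP[|]; lra.
Qed.

End Necessity.

Local Open Scope nat_scope.

(** Among the [N + 1] vertices of a lift that lie at the multiples of [L], two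
    have the same last letter. *)
Lemma path_mx_loop L u p : path hadj u p ->
  (forall n, hreach n u (last u p) -> size p <= n) ->
  path_mx G J u p != 0%R -> N * L <= size p ->
  exists x r i, exists2 c, 0 < c & [/\ path hadj x r,
    forall b, hreach b x (last x r) -> size r <= b,
    path_mx G J x r i i != 0%R & size r = c * L].
Proof.
move=> pP min M0 sp.
have [i [j Mij]] : exists i j, path_mx G J u p i j != 0%R.
  apply: contrapT => M; move/eqP: M0; apply; apply/matrixP => i j; rewrite mxE.
  by apply: contrapT => /eqP Mij; apply: M; exists i, j.
have [q [qP qp ql]] := (path_mx_lift i j pP).1 Mij.
have {sp} sq : N * L <= size q by rewrite -(size_map behead) qp.
pose z t := nth (i :: u) ((i :: u) :: q) (t * L).
pose f (t : 'I_N.+1) := head i (z t).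
have [s [t [st fst]]] : exists s t : 'I_N.+1, s < t /\ f s = f t.
  have /injectivePn[s [t st fst]] : ~~ injectiveb f.
    by apply/injectiveP => /leq_card; rewrite !card_ord ltnn.
  have [lt_st|lt_ts|/val_inj/eqP] := ltngtP s t; last by rewrite (negPf st).
  - by exists s, t.
  - by exists t, s.
have sL : s * L <= t * L by rewrite leq_mul2r ltnW ?orbT.
have tL : t * L <= size q.
  by apply: leq_trans sq; rewrite leq_mul2r -ltnS ltn_ord orbT.
have [q0 [q0P q0l q0s]] := path_sub qP (leq0n _) (leq_trans sL tL).
have [q1 [q1P q1l q1s]] := path_sub qP sL tL.
have [q2 [q2P q2l q2s]] := path_sub qP tL (leqnn _).
rewrite -/(z s) -/(z t) in q0P q0l q1P q1l q2P q2l.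
have sz t' : t' * L <= size q -> exists i' x, z t' = i' :: x.
  move=> t'q; have [q' [q'P q'l _]] := path_sub qP (leq0n _) t'q.
  have := hreach_size (hreach_path (path_lifted q'P)); rewrite q'l -/(z t').
  by case: (z t') => // i' x _; exists i', x.
have [i' [x zs]] := sz s (leq_trans sL tL).
have [i'' [y zt]] := sz t tL.
have ei : i'' = i' by move: fst; rewrite /f zs zt /=.
subst i''.
exists x, (map behead q1), i', (t - s); first by rewrite subn_gt0.
have last_behead w r : last (behead w) (map behead r) = behead (last w r).
  exact: last_map.
have xy : last x (map behead q1) = y.
  by rewrite -[x]/(behead (i' :: x)) -zs last_behead q1l zt.
split.
- by have := path_behead q1P; rewrite zs.
- move=> b xby.
  have h0 : hreach (s * L) u x.
    have := hreach_path (path_behead q0P).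
    by rewrite size_map q0s subn0 last_behead q0l zs.
  have h2 : hreach (size q - t * L) y (last u p).
    have := hreach_path (path_behead q2P).
    rewrite size_map q2s last_behead q2l zt /= -last_nth.
    by rewrite ql.
  rewrite xy in xby.
  have := min _ (hreach_trans h0 (hreach_trans xby h2)).
  by rewrite -qp !size_map q1s; lia.
- apply/path_mx_lift; first by have := path_behead q1P; rewrite zs.
  by exists q1; rewrite -zs q1l zt xy.
- by rewrite size_map q1s mulnBl.
Qed.

Local Open Scope ring_scope.

Lemma path_mx_of_hyperbolic (R : realType) : (0 < N)%N -> hyperbolic R G J ->
  exists k, (0 < k)%N /\ forall u p,
      shortest_hpath G J u p -> (k < size p)%N -> path_mx G J u p = 0.
Proof.
move=> N0 [delta delta0 hyp].
have [m mdelta] : exists m : nat, 2 * delta < m%:R.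
  by exists (Num.bound (2 * delta)); apply: archi_boundP; rewrite mulr_ge0.
have m0 : (0 < m)%N.
  by rewrite -(ltr_nat R); apply: le_lt_trans mdelta; rewrite mulr_ge0.
(* Even gaps [m.*2] between the compared vertices give every loop a midpoint. *)
exists (N * m.*2)%N; split=> [|u p pS pk].
  by rewrite muln_gt0 N0 double_gt0.
have pP := pS.1.1; apply/eqP; apply: contraT => M0.
have [x [r [i [c c0 [rP r_min r_loop sr]]]]] :=
  path_mx_loop pP ((shortest_hpathP pP).2 pS) M0 (ltnW pk).
have := hyperbolic_loop rP (erefl _) r_min r_loop hyp (m := (c * m)%N).
rewrite sr doubleMr => /(_ (erefl _)).
rewrite leNgt (lt_le_trans mdelta) // ler_nat leq_pmull //.
Qed.

End SubstitutionGraph.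

Theorem theorem2 (R : realType) (N : nat) (N_ge2 : (2 <= N)%N)
    (G : rel 'I_N)
    (G_noloop : forall i : 'I_N, ~~ G i i)
    (G_simple : forall i j : 'I_N, G i j -> ~~ G j i)
    (G_nonempty : exists i j : 'I_N, G i j)
    (J : rel ('I_N + 'I_N))
    (J_bipartite : forall x y : 'I_N + 'I_N,
       J x y -> exists i j : 'I_N, x = inl i /\ y = inr j)
    (J_nonempty : exists x y : 'I_N + 'I_N, J x y) :
  hyperbolic R G J <->
  exists k : nat, (0 < k)%N /\
    forall (u : word N) (p : seq (word N)),
      shortest_hpath G J u p -> (k < size p)%N -> path_mx G J u p = 0.
Proof.
split=> [|[k [_ mx0]]].
  by apply: path_mx_of_hyperbolic => //; apply: ltnW.
exact: hyperbolic_of_path_mx mx0 _.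
Qed.
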